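(* Let $m\ge n\ge1$ be integers, $C>0$, $0<a_1\le a_2\le\cdots$ with $a_i\to\infty$, and $\Theta(C)=\{\theta\in\mathbb R^n:\sum_{i=1}^n a_i^2\theta_i^2\le C\}$. Put $v_k=1/k$. Let $\tilde\lambda$ be a solution of $$\sum_{i=1}^n a_i^2\left[(v_n-v_{n+m})\sqrt{1+\frac{4\tilde\lambda/a_i^2}{v_n-v_{n+m}}}-(v_n+v_{n+m})\right]_+=2C,$$ and for $i=1,\dots,n$ let $$\tilde\theta_i^2=\frac12\left[(v_n-v_{n+m})\sqrt{1+\frac{4\tilde\lambda/a_i^2}{v_n-v_{n+m}}}-(v_n+v_{n+m})\right]_+ .$$ With $\hat p_S$ the Bayes predictive density under the Gaussian prior $N(0,S)$, and $R(\theta,\hat p)$ the average Kullback--Leibler risk (see context), and with the infima over all diagonal matrices $S=\mathrm{diag}(s_1,\dots,s_n)$ with $s_i\ge0$, the linear minimax risk $R_L(\Theta)=\inf_S\sup_{\theta\in\Theta(C)}R(\theta,\hat p_S)$ is given by $$R_L(\Theta)=\inf_S\sup_{\theta\in\Theta(C)}R(\theta,\hat p_S)=\sup_{\theta\in\Theta(C)}\inf_S R(\theta,\hat p_S)=\frac{n}{2m}\log\frac{v_n}{v_{n+m}}+\frac1{2m}\sum_{i=1}^n\log\frac{v_{n+m}+\tilde\theta_i^2}{v_n+\tilde\theta_i^2}.$$ Moreover, the linear minimax estimator (the $\hat p_S$ attaining $\inf_S\sup_{\theta\in\Theta(C)}R(\theta,\hat p_S)$) is $\hat p_{\tilde V}$,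 the Bayes predictive density under the Gaussian prior $N(0,\tilde V)$ with $\tilde V=\mathrm{diag}(\tilde\theta_1^2,\dots,\tilde\theta_n^2)$; namely, $\hat p_{\tilde V}(\cdot\mid x)$ is the density of $N(\theta_{\tilde V},\Sigma_{\tilde V})$ with $$\theta_{\tilde V}=\left(\frac{\tilde\theta_1^2}{\tilde\theta_1^2+v_n}x_1,\dots,\frac{\tilde\theta_n^2}{\tilde\theta_n^2+v_n}x_n\right)',\qquad \Sigma_{\tilde V}=\mathrm{diag}\left(\frac{\tilde\theta_1^2v_n}{\tilde\theta_1^2+v_n}+v_m,\dots,\frac{\tilde\theta_n^2v_n}{\tilde\theta_n^2+v_n}+v_m\right).$$
   Context: Notation: $[x]_+=\max(x,0)$. Gaussian sequence model: given $\theta\in\mathbb R^n$, $X\sim N(\theta,v_nI_n)$ and $\tilde X\sim N(\theta,v_mI_n)$ are independent, with $v_n=1/n$, $v_m=1/m$; $p(x\mid\theta)$ and $p(\tilde x\mid\theta)$ denote their densities. A predictive density $\hat p(\tilde x\mid x)$ is a non-negative function integrating to 1 in $\tilde x\in\mathbb R^n$ for each $x\in\mathbb R^n$. Its average Kullback--Leibler risk is $$R(\theta,\hat p)=\frac1m E_{X,\tilde X\mid\theta}\log\frac{p(\tilde X\mid\theta)}{\hat p(\tilde X\mid X)}.$$ For $S=\mathrm{diag}(s_1,\dots,s_n)$ with $s_i\ge0$, let $\pi_S=N(0,S)$ on $\mathbb R^n$ (a coordinate with $s_i=0$ is a point mass at 0), and $$\hat p_S(\tilde x\mid x)=\frac{\int_{\mathbb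 R^n}p(x\mid\theta)p(\tilde x\mid\theta)\,\pi_S(d\theta)}{\int_{\mathbb R^n}p(x\mid\theta)\,\pi_S(d\theta)} .$$ These $\hat p_S$ are called linear predictive densities. *)

(* Defs.v *)
From HB Require Import structures.
From mathcomp Require Import all_boot all_order all_algebra.
From mathcomp Require Import all_classical all_reals all_analysis.

Set Implicit Arguments.
Unset Strict Implicit.
Unset Printing Implicit Defensive.

Import Order.TTheory GRing.Theory Num.Theory.
Import numFieldNormedType.Exports.

Local Open Scope classical_set_scope.
Local Open Scope ring_scope.

(** [R^n] is [n.-tuple R] with the product sigma-algebra; a diagonal matrix is
    represented by the tuple of its diagonal entries. *)

Section product_law.
Context d (T : measurableType d) (R : realType).

Definition tcons n (p : T * n.-tuple T) : n.+1.-tuple T :=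
  [the n.+1.-tuple T of p.1 :: p.2].

Lemma measurable_tcons n : measurable_fun [set: T * n.-tuple T] (@tcons n).
Proof. exact: measurable_cons measurable_fst measurable_snd. Qed.

HB.instance Definition _ n :=
  isMeasurableFun.Build _ _ _ _ (@tcons n) (@measurable_tcons n).

(** The law on [T^n] of independent coordinates with laws [P i]. *)
Fixpoint product_law n : ('I_n -> probability T R) -> probability (n.-tuple T) R :=
  match n with
  | 0 => fun=> \d_([tuple] : 0.-tuple T)
  | k.+1 => fun P =>
      distribution (P ord0 \x product_law (fun i => P (lift ord0 i)))%E (@tcons k)
  end.

End product_law.

Section gaussian.
Context (R : realType).

(** [N(mu, s)] with variance [s >= 0].  The case [s = 0] is separate because
    [normal_prob mu 0] is the uniform law on [0, 1], not a point mass. *)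
Definition normal_law (mu s : R) : probability (measurableTypeR R) R :=
  if s == 0 then [the probability _ _ of \d_(mu : measurableTypeR R)]
  else [the probability _ _ of normal_prob mu (Num.sqrt s)].

(** [N(mu, diag s)]. *)
Definition gauss_law n (mu s : n.-tuple R) :
    probability (n.-tuple (measurableTypeR R)) R :=
  product_law (fun i => normal_law (tnth mu i) (tnth s i)).

(** The Lebesgue density of [N(mu, diag s)], for [s] with positive entries. *)
Definition gauss_pdf n (mu s x : n.-tuple R) : R :=
  \prod_(i < n) normal_pdf (tnth mu i) (Num.sqrt (tnth s i)) (tnth x i).

End gaussian.

Section sequence_model.
Context (R : realType).

Definition v (k : nat) : R := k%:R^-1.

(** The diagonal of [v_k I_n]. *)
Definition vI k n : n.-tuple R := [tuple v k | i < n].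

(** The risk is extended-real valued: the log ratio is [+oo] where [phat]
    vanishes ([gauss_pdf] is positive there). *)
Definition risk n m (theta : n.-tuple R) (phat : n.-tuple R -> n.-tuple R -> R)
    : \bar R :=
  ((m%:R^-1)%:E *
   \int[gauss_law theta (vI n n) \x gauss_law theta (vI m n)]_z
     lne ((gauss_pdf theta (vI m n) z.2)%:E / (phat z.1 z.2)%:E))%E.

(** [bayes_pred m S x xt] is the predictive density at [xt] given [x], under
    the prior [N(0, diag S)]. *)
Definition bayes_pred n m (S x xt : n.-tuple R) : R :=
  let prior := gauss_law [tuple 0 | i < n] S in
  (\int[prior]_theta (gauss_pdf theta (vI n n) x * gauss_pdf theta (vI m n) xt)) /
  (\int[prior]_theta gauss_pdf theta (vI n n) x).

Definition nonneg_diag n : set (n.-tuple R) :=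
  [set S | forall i, 0 <= tnth S i].

(** [a] is indexed from 0: [a i] is the (i+1)-st semi-axis weight. *)
Definition ellipsoid n (a : nat -> R) (C : R) : set (n.-tuple R) :=
  [set theta | \sum_(i < n) a i ^+ 2 * tnth theta i ^+ 2 <= C].

Definition max_risk n m (Theta : set (n.-tuple R)) (S : n.-tuple R) : \bar R :=
  ereal_sup [set risk m theta (bayes_pred m S) | theta in Theta].

Definition linear_minimax_risk n m (Theta : set (n.-tuple R)) : \bar R :=
  ereal_inf [set max_risk m Theta S | S in @nonneg_diag n].

Definition linear_maximin_risk n m (Theta : set (n.-tuple R)) : \bar R :=
  ereal_sup [set ereal_inf [set risk m theta (bayes_pred m S) | S in @nonneg_diag n]
            | theta in Theta].

Definition pos_part (x : R) : R := Num.max x 0.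

Definition pinsker_weight n m (lambda ai : R) : R :=
  pos_part ((v n - v (n + m)) *
              Num.sqrt (1 + (4 * lambda / ai ^+ 2) / (v n - v (n + m)))
            - (v n + v (n + m))).

(** The least favourable squared means [theta_i^2]. *)
Definition pinsker_var n m (a : nat -> R) (lambda : R) : n.-tuple R :=
  [tuple pinsker_weight n m lambda (a i) / 2 | i < n].

End sequence_model.

(* Main.v *)
Require Import Defs.
From mathcomp Require Import all_boot all_order all_algebra ring lra.
From mathcomp Require Import all_classical all_reals all_analysis.
From mathcomp Require Import measurable_realfun.
Set Implicit Arguments.
Unset Strict Implicit.
Unset Printing Implicit Defensive.
Import Order.TTheory GRing.Theory Num.Theory.
Import numFieldNormedType.Exports.
Local Open Scope classical_set_scope.
Local Open Scope ring_scope.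

(** Put [p = v_n], [q = v_(n+m)].  All laws are products, and the risk of the
    Bayes density for [N(0, S)] is [1/m] times the sum over [i] of
    [1/2 (ln (p/q) + g(s_i) + g'(s_i) (theta_i^2 - s_i))] with
    [g(t) = ln ((t + q) / (t + p))]: a tangent line of the strictly concave [g].
    Hence for fixed [theta] the risk is minimal exactly at [s_i = theta_i^2],
    while for [S = V] it is affine in [(theta_i^2)_i] with slopes [g'(V_i)].  The
    definition of [V] says that [g'(V_i) = a_i^2 / lambda] when [V_i > 0] and
    [g'(0) <= a_i^2 / lambda] otherwise, so on the ellipsoid the risk of [V] is
    largest at [theta_i^2 = V_i], where [sum_i a_i^2 V_i = C]: this is a
    saddle point. *)

(** * One-dimensional Gaussian densities: product, tilting and rescaling identities *)

Section gaussian_density.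
Context {R : realType}.
Implicit Types mu s t x y : R.
Local Notation leb := (@lebesgue_measure R).

Lemma normal_pdf_sqrtE mu s x : 0 < s ->
  normal_pdf mu (Num.sqrt s) x =
  (Num.sqrt (s * (2 * pi)))^-1 * expR (- ((x - mu) ^+ 2 / (2 * s))).
Proof.
move=> s0; rewrite normal_pdfE ?sqrtr_eq0 -?ltNge//.
rewrite /normal_peak /normal_fun sqr_sqrtr ?ltW//.
congr (_^-1 * expR _).
  by congr Num.sqrt; rewrite -mulrnAr -[in LHS]mulr_natl.
by rewrite mulNr -[X in _ / X]mulr_natl.
Qed.

Lemma normal_pdf_sqrt_gt0 mu s x : 0 < s -> 0 < normal_pdf mu (Num.sqrt s) x.
Proof.
move=> s0; rewrite normal_pdf_sqrtE// mulr_gt0 ?expR_gt0// invr_gt0 sqrtr_gt0.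
by rewrite mulr_gt0// mulr_gt0 ?pi_gt0.
Qed.

(* Completing the square in [t]: prior times likelihood is marginal times
   posterior. *)
Lemma normal_pdf_mul mu s r t x : 0 < s -> 0 < r ->
  normal_pdf t (Num.sqrt r) x * normal_pdf mu (Num.sqrt s) t =
  normal_pdf mu (Num.sqrt (s + r)) x *
  normal_pdf ((s * x + r * mu) / (s + r)) (Num.sqrt (s * r / (s + r))) t.
Proof.
move=> s0 r0; have sr0 : 0 < s + r by rewrite addr_gt0.
have srV0 : 0 < s * r / (s + r) by rewrite divr_gt0// mulr_gt0.
rewrite !normal_pdf_sqrtE//.
rewrite mulrACA -expRD [in RHS]mulrACA -expRD -!invfM; congr (_^-1 * expR _).
  rewrite -!sqrtrM; try by rewrite mulr_ge0 ?ltW// mulr_gt0 ?pi_gt0.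
  congr Num.sqrt; field; exact: lt0r_neq0.
field; rewrite !lt0r_neq0//.
Qed.

(** Completing the square: an exponential tilt only shifts the mean. Integrated, this gives the
    moment generating function. *)
Lemma normal_pdf_tilt mu s t x : 0 < s ->
  expR (t * (x - mu)) * normal_pdf mu (Num.sqrt s) x =
  expR (t ^+ 2 * s / 2) * normal_pdf (mu + t * s) (Num.sqrt s) x.
Proof.
move=> s0; rewrite !normal_pdf_sqrtE// mulrCA -expRD [RHS]mulrCA -expRD.
by congr (_ * expR _); field; rewrite lt0r_neq0.
Qed.

(** A quadratic exponent only rescales the variance. With [r] as parameter the normalizing factor
    [r^-1] has no root, and both signs of the exponent are covered: growth for [r < 1], decay for
    [r > 1]. *)
Lemma normal_pdf_damp mu s r x : 0 < s -> 0 < r ->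
  expR ((1 - r ^+ 2) / (2 * s) * (x - mu) ^+ 2) *
    normal_pdf mu (Num.sqrt s) x =
  r^-1 * normal_pdf mu (Num.sqrt (s / r ^+ 2)) x.
Proof.
move=> s0 r0; have r20 : 0 < r ^+ 2 by rewrite exprn_gt0.
have -> : r^-1 = (Num.sqrt (r ^+ 2))^-1 by rewrite sqrtr_sqr ger0_norm ?ltW.
rewrite !normal_pdf_sqrtE ?divr_gt0// mulrCA -expRD [RHS]mulrA -invfM.
rewrite -sqrtrM ?ltW//.
congr ((Num.sqrt _)^-1 * expR _); field; rewrite ?lt0r_neq0//.
Qed.

(** The Radon-Nikodym derivative and [normal_pdf] have the same integral over every measurable set,
    hence agree almost everywhere. *)
Lemma ge0_integral_normal_prob mu s (f : R -> \bar R) :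
  (forall x, (0 <= f x)%E) -> measurable_fun [set: R] f ->
  (\int[normal_prob mu s]_x f x =
   \int[leb]_x (f x * (normal_pdf mu s x)%:E))%E.
Proof.
move=> f0 mf; have dom := @normal_prob_dominates R mu s.
rewrite -(Radon_Nikodym_SigmaFinite.change_of_variables dom)//.
have mpdf : measurable_fun [set: R] (fun x => (normal_pdf mu s x)%:E).
  by apply/measurable_EFinP; exact: measurable_normal_pdf.
have iRN := Radon_Nikodym_SigmaFinite.f_integrable dom.
apply: ae_eq_integral => //.
- by apply: emeasurable_funM => //; exact: measurable_int iRN.
- exact: emeasurable_funM.
- apply: ae_eqe_mul2l; apply: integral_ae_eq => // E _ mE.
  by rewrite -Radon_Nikodym_SigmaFinite.f_integral.
Qed.

Lemma ge0_integral_normal_law mu s (f : R -> \bar R) : 0 < s ->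
  (forall x, (0 <= f x)%E) -> measurable_fun [set: R] f ->
  (\int[normal_law mu s]_x f x =
   \int[leb]_x (f x * (normal_pdf mu (Num.sqrt s) x)%:E))%E.
Proof.
by move=> s0 f0 mf; rewrite /normal_law gt_eqF// ge0_integral_normal_prob.
Qed.

End gaussian_density.

(** * Gaussian mixtures, and the first two moments of a Gaussian law *)

Section gaussian_integrals.
Context {R : realType}.
Implicit Types mu s : R.

Lemma measurable_normal_pdf_mean r (x : R) : 0 < r ->
  measurable_fun [set: R] (fun t => (normal_pdf t (Num.sqrt r) x)%:E).
Proof.
move=> r0; apply/measurable_EFinP.
(* The density is symmetric in its mean and its argument. *)
have -> : (fun t => normal_pdf t (Num.sqrt r) x) = normal_pdf x (Num.sqrt r).
  by apply/funext => t; rewrite !normal_pdf_sqrtE// -sqrrN opprB.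
exact: measurable_normal_pdf.
Qed.

Lemma integral_normal_law_pdf mu s r (x : R) : 0 <= s -> 0 < r ->
  (\int[normal_law mu s]_t (normal_pdf t (Num.sqrt r) x)%:E =
   (normal_pdf mu (Num.sqrt (s + r)) x)%:E)%E.
Proof.
rewrite le0r => /orP[/eqP -> r0|s0 r0].
  rewrite /normal_law eqxx integral_dirac ?diracT ?mul1e ?add0r//.
  exact: measurable_normal_pdf_mean.
rewrite ge0_integral_normal_law//; last 2 first.
- by move=> t; rewrite lee_fin normal_pdf_ge0.
- exact: measurable_normal_pdf_mean.
under eq_integral do rewrite -EFinM normal_pdf_mul// EFinM.
rewrite integralZl//; last exact: integrable_normal_pdf.
by rewrite integral_normal_pdf mule1.
Qed.

(** Bayes' rule: [normal_pdf_mul] replaces prior times first likelihood by marginal times posterior,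
    and the second likelihood is then integrated against the posterior by [integral_normal_law_pdf].
    A point mass ([s = 0]) is treated directly. *)
Lemma integral_normal_law_pdf2 mu s r q (x y : R) : 0 <= s -> 0 < r -> 0 < q ->
  (\int[normal_law mu s]_t
     (normal_pdf t (Num.sqrt r) x * normal_pdf t (Num.sqrt q) y)%:E =
   (normal_pdf mu (Num.sqrt (s + r)) x *
    normal_pdf ((s * x + r * mu) / (s + r))
      (Num.sqrt (s * r / (s + r) + q)) y)%:E)%E.
Proof.
rewrite le0r => /orP[/eqP -> r0 q0|s0 r0 q0].
  rewrite /normal_law eqxx integral_dirac ?diracT ?mul1e//.
    by rewrite !mul0r !add0r mulrAC mulfV ?gt_eqF ?mul1r.
  apply/measurable_EFinP; apply: measurable_funM;
    apply/measurable_EFinP; exact: measurable_normal_pdf_mean.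
rewrite ge0_integral_normal_law//; last 2 first.
- by move=> t; rewrite lee_fin mulr_ge0 ?normal_pdf_ge0.
- apply/measurable_EFinP; apply: measurable_funM;
    apply/measurable_EFinP; exact: measurable_normal_pdf_mean.
under eq_integral do rewrite -EFinM mulrAC normal_pdf_mul// -[X in X%:E]mulrA EFinM.
rewrite ge0_integralZl//; last 3 first.
- apply/measurable_EFinP; apply: measurable_funM; first exact: measurable_normal_pdf.
  by apply/measurable_EFinP; exact: measurable_normal_pdf_mean.
- by move=> t _; rewrite lee_fin mulr_ge0 ?normal_pdf_ge0.
- by rewrite lee_fin normal_pdf_ge0.
have sr0 : 0 < s * r / (s + r) by rewrite divr_gt0 ?mulr_gt0 ?addr_gt0.
rewrite EFinM; congr (_ * _)%E.
rewrite -(integral_normal_law_pdf _ _ (ltW sr0) q0).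
rewrite [RHS](ge0_integral_normal_law _ sr0); last 2 first.
- by move=> t; rewrite lee_fin normal_pdf_ge0.
- exact: measurable_normal_pdf_mean.
by under eq_integral do rewrite EFinM muleC.
Qed.

(** Integrate [1 + u <= expR u]. When exponential moments are known for all [k] near [0], these
    inequalities determine the mean [M]. *)
Lemma expR_integral_ge d (T : measurableType d) (P : probability T R)
    (f : T -> R) (k M e : R) :
  P.-integrable [set: T] (EFin \o f) ->
  (\int[P]_x (f x)%:E = M%:E)%E ->
  (\int[P]_x (expR (k * f x))%:E = e%:E)%E -> 1 + k * M <= e.
Proof.
move=> fi fM fe; rewrite -lee_fin -fe EFinD EFinM -fM -integralZl//.
rewrite -[1%:E in leLHS](probability_setT P) -[P setT]mul1e -integral_cst//.
have c1 : P.-integrable [set: T] (cst 1%E) by exact: finite_measure_integrable_cst.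
have kf : P.-integrable [set: T] (fun x => k%:E * (f x)%:E)%E by exact: integrableZl.
have mf : measurable_fun [set: T] f by apply/measurable_EFinP; exact: measurable_int fi.
rewrite -integralD//; apply: le_integral => //.
- exact: integrableD.
- apply/integrableP; split.
    by apply/measurable_EFinP/measurableT_comp => //; exact: measurable_funM.
  under eq_integral do rewrite /= ger0_norm ?expR_ge0//.
  by rewrite fe ltry.
- by move=> x _; rewrite -EFinM -EFinD lee_fin expR_ge1Dx.
Qed.

Let mX mu : measurable_fun [set: R] (fun x => x - mu).
Proof. exact: measurable_funB. Qed.

Lemma integral_normal_law_tilt mu s (t : R) : 0 < s ->
  (\int[normal_law mu s]_x (expR (t * (x - mu)))%:E =
   (expR (t ^+ 2 * s / 2))%:E)%E.
Proof.
move=> s0; rewrite ge0_integral_normal_law//; last first.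
  by apply/measurable_EFinP/measurableT_comp => //; exact: measurable_funM.
under eq_integral do rewrite -EFinM normal_pdf_tilt// EFinM.
rewrite integralZl//; last exact: integrable_normal_pdf.
by rewrite integral_normal_pdf mule1.
Qed.

Lemma integral_normal_law_damp mu s r : 0 < s -> 0 < r ->
  (\int[normal_law mu s]_x (expR ((1 - r ^+ 2) / (2 * s) * (x - mu) ^+ 2))%:E =
   (r^-1)%:E)%E.
Proof.
move=> s0 r0; rewrite ge0_integral_normal_law//; last first.
  apply/measurable_EFinP/measurableT_comp => //; apply: measurable_funM => //.
  exact: measurable_funX.
under eq_integral do rewrite -EFinM normal_pdf_damp// EFinM.
rewrite integralZl//; last exact: integrable_normal_pdf.
by rewrite integral_normal_pdf mule1.
Qed.

(** Domination: [k y^2 <= expR (k y^2)], where the right-hand side is integrable for the positive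
    [k] given by [r = 1/2] in [integral_normal_law_damp]. *)
Lemma integrable_normal_law_sqr mu s : 0 < s ->
  (normal_law mu s).-integrable [set: R] (fun x => ((x - mu) ^+ 2)%:E).
Proof.
move=> s0; have h0 : (0 : R) < 2^-1 by rewrite invr_gt0.
have := integral_normal_law_damp mu s0 h0; set k := (_ / _) => ke.
have k0 : 0 < k.
  by rewrite divr_gt0 ?mulr_gt0// subr_gt0 exprn_ilt1 ?invr_ge0// invf_lt1// ltr1n.
have mX2 : measurable_fun [set: R] (fun x : R => (x - mu) ^+ 2).
  exact: measurable_funX.
have mE : measurable_fun [set: R] (fun x : R => expR (k * (x - mu) ^+ 2)).
  by apply/measurableT_comp => //; exact: measurable_funM.
apply: (le_integrable measurableT _ _
  (_ : (normal_law mu s).-integrable [set: R]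
    (fun x => k^-1%:E * (expR (k * (x - mu) ^+ 2))%:E)%E)) => //.
- exact/measurable_EFinP.
- move=> x _ /=; rewrite ger0_norm ?sqr_ge0//.
  rewrite lee_fin [leRHS]ger0_norm; last by rewrite mulr_ge0 ?expR_ge0 ?invr_ge0 ?ltW.
  rewrite ler_pdivlMl//; apply: le_trans (expR_ge1Dx _).
  by rewrite lerDr.
- apply: integrableZl => //; apply/integrableP; split; first exact/measurable_EFinP.
  under eq_integral do rewrite /= ger0_norm ?expR_ge0//.
  by rewrite ke ltry.
Qed.

Lemma integrable_normal_law_center mu s : 0 < s ->
  (normal_law mu s).-integrable [set: R] (fun x => (x - mu)%:E).
Proof.
move=> s0; have H (y : R) : `|y| <= 1 + y ^+ 2.
  have := sqr_ge0 (y + 2^-1); have := sqr_ge0 (y - 2^-1).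
  by rewrite ler_norml => ? ?; apply/andP; split; lra.
apply: (le_integrable measurableT _ _
  (_ : (normal_law mu s).-integrable [set: R]
    (fun x => (1 + (x - mu) ^+ 2)%:E))) => //.
- by apply/measurable_EFinP; exact: (mX mu).
- move=> x _ /=; rewrite lee_fin [leRHS]ger0_norm ?addr_ge0 ?sqr_ge0//.
- exact: (integrableD measurableT (finite_measure_integrable_cst _ 1 measurableT)
    (integrable_normal_law_sqr mu s0)).
Qed.

(* [1 + t M <= E exp (t (X - mu)) = exp (t^2 s / 2)] for every real [t], so the
   mean [M] of [X - mu] is the derivative of the right-hand side at [0]. *)
Lemma integral_normal_law_center mu s : 0 < s ->
  (\int[normal_law mu s]_x (x - mu)%:E = 0)%E.
Proof.
move=> s0; have i1 := integrable_normal_law_center mu s0.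
set I := (\int[_]_x _)%E.
have Ifin : I \is a fin_num by apply: integrable_fin_num i1.
rewrite -(fineK Ifin); set M := fine I.
have H t : 1 + t * M <= expR (t ^+ 2 * s / 2).
  apply: (@expR_integral_ge _ _ (normal_law mu s) (fun x => x - mu)) => //.
    by rewrite fineK.
  exact: integral_normal_law_tilt.
congr EFin; apply/eqP; apply/negPn/negP => M0.
have M20 : 0 < M ^+ 2 by rewrite exprn_even_gt0.
(* Take [t = c M] with [c] small enough that [u + c s / 2 < 1], where [u = t^2 s / 2] is second
   order in [c] while the gain [t M = c M^2] is first order. *)
pose c := (1 + s * (1 + M ^+ 2))^-1.
have den0 : 0 < 1 + s * (1 + M ^+ 2).
  by rewrite addr_gt0// mulr_gt0// addr_gt0.
have c0 : 0 < c by rewrite invr_gt0.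
have cE : c * (1 + s * (1 + M ^+ 2)) = 1 by rewrite mulVf ?gt_eqF.
have c1 : c <= 1.
  by rewrite invf_le1// lerDl mulr_ge0 ?ltW// addr_gt0.
have {H} := H (c * M); set u := (c * M) ^+ 2 * s / 2 => H.
have u1 : u + c * s / 2 < 1.
  have : u <= c * (s * M ^+ 2) / 2.
    have -> : u = c * (c * (s * M ^+ 2)) / 2 by rewrite /u; ring.
    rewrite ler_pM2r ?invr_gt0// ler_piMl//.
    by rewrite mulr_ge0 ?(ltW c0)// mulr_ge0 ?ltW.
  nra.
have cs0 : 0 < c * s by rewrite mulr_gt0.
(* This is [1 - u <= expR (- u)]; it turns the exponential bound into a polynomial one. *)
have : expR u * (1 - u) <= 1.
  rewrite -[leRHS]expR0 -(subrr u) expRD ler_pM2l ?expR_gt0//.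
  exact: expR_ge1Dx.
have : (1 + c * M * M) * (1 - u) <= expR u * (1 - u).
  by rewrite ler_wpM2r// subr_ge0; lra.
have cM : 0 < c * M ^+ 2 by rewrite mulr_gt0.
have uE : u = (c * M ^+ 2) * (c * s / 2) by rewrite /u; ring.
move: H cM uE u1 cs0 => _; rewrite -(mulrA c M) -expr2.
move: (c * M ^+ 2) (c * s) => p q p0 -> pq q0 h1 h2.
have : p * (1 - p * (q / 2) - q / 2) <= 0 by lra.
by apply/negP; rewrite -ltNge mulr_gt0//; lra.
Qed.

(* Likewise with [1 - k M <= E exp (- k (X - mu)^2) = 1 / r], where
   [r^2 = 1 + 2 k s] runs over a neighbourhood of [1]. *)
Lemma integral_normal_law_sqr mu s : 0 < s ->
  (\int[normal_law mu s]_x ((x - mu) ^+ 2)%:E = s%:E)%E.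
Proof.
move=> s0; have i2 := integrable_normal_law_sqr mu s0.
set I := (\int[_]_x _)%E.
have Ifin : I \is a fin_num by apply: integrable_fin_num i2.
rewrite -(fineK Ifin); set M := fine I.
have M0 : 0 <= M.
  by apply: fine_ge0; apply: integral_ge0 => x _; rewrite lee_fin sqr_ge0.
(* The factor [r - 1] is kept on both sides: its sign makes [2 s] a lower bound of [(r + 1) r M] for
   [r > 1] and an upper bound for [r < 1]. *)
have H r : 0 < r -> 2 * s * (r - 1) <= (r - 1) * ((r + 1) * r * M).
  move=> r0; have : 1 + (1 - r ^+ 2) / (2 * s) * M <= r^-1.
    apply: (@expR_integral_ge _ _ (normal_law mu s) (fun x => (x - mu) ^+ 2)) => //.
      by rewrite fineK.
    exact: integral_normal_law_damp.
  rewrite -(ler_pM2l (_ : 0 < 2 * s * r)) ?mulr_gt0//.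
  have -> : 2 * s * r * (1 + (1 - r ^+ 2) / (2 * s) * M) =
            2 * s * r + (1 - r ^+ 2) * r * M by field; rewrite gt_eqF.
  rewrite mulfK ?gt_eqF// => ?; nra.
congr EFin; apply/eqP; rewrite eq_le; apply/andP; split; rewrite leNgt; apply/negP.
- move=> sM; have M1 : 0 < M by exact: lt_trans sM.
  (* At [r = 1 - h] the bound reads [(2 - h) (1 - h) M <= 2 s], but the left side exceeds
     [2 M - 3 h M = (M + 3 s) / 2 > 2 s]. *)
  pose h := (M - s) / (2 * M).
  have h0 : 0 < h by rewrite divr_gt0 ?subr_gt0// mulr_gt0.
  have hM : h * M = (M - s) / 2 by rewrite /h; field; rewrite gt_eqF.
  have h1 : h < 1 by rewrite ltr_pdivrMr ?mulr_gt0//; lra.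
  have := H (1 - h); rewrite subr_gt0 => /(_ h1).
  rewrite (_ : 1 - h - 1 = - h); last by ring.
  rewrite mulrN mulNr lerN2 [leLHS]mulrC ler_pM2r//.
  have := sqr_ge0 h; nra.
(* Now [r = 1 + h]. The denominator uses [M + s] since [M] may still be [0]; [h < 1] and
   [h M < (s - M) / 2] give [(2 + h) (1 + h) M < 2 s]. *)
- move=> Ms; pose h := (s - M) / (2 * (M + s)).
  have Ms0 : 0 < M + s by rewrite ltr_wpDl.
  have h0 : 0 < h by rewrite divr_gt0 ?subr_gt0// mulr_gt0.
  have hM : h * (M + s) = (s - M) / 2 by rewrite /h; field; rewrite gt_eqF.
  have h1 : h < 1 by rewrite ltr_pdivrMr ?mulr_gt0//; lra.
  have := H (1 + h); rewrite addr_gt0// => /(_ isT).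
  rewrite (_ : 1 + h - 1 = h); last by ring.
  rewrite [leRHS]mulrC ler_pM2r//.
  nra.
Qed.

End gaussian_integrals.

(** * Marginals and integrals under the law of independent coordinates *)

Section product_law.
Context d (T : measurableType d) (R : realType).

(** The preimage of [A] is a rectangle whose other side has mass 1. Integrals of functions of one
    coordinate thus reduce to the marginal law. *)
Lemma product_law_tnth n (P : 'I_n -> probability T R) (i : 'I_n) A :
  measurable A ->
  pushforward (product_law P) (@tnth n T ^~ i) A = P i A.
Proof.
elim: n P i => [P []//|n IH P i] mA; rewrite /pushforward /=.
rewrite /distribution /pushforward /=.
case: (unliftP ord0 i) => [j ->|->].
- rewrite (_ : _ @^-1` _ = setT `*` ((@tnth n T ^~ j) @^-1` A)).
    rewrite product_measure1E//; last first.
      by rewrite -[X in measurable X]setTI; exact: measurable_tnth.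
    apply: etrans (IH (fun k => P (lift ord0 k)) j mA).
    apply: (etrans _ (mul1e _)); congr (_ * _)%E.
    exact: probability_setT.
  apply/seteqP; split => -[x s] /=; rewrite /tcons /= ?tnthS; first by split.
  by case.
- rewrite (_ : _ @^-1` _ = A `*` setT).
    rewrite product_measure1E//; apply: (etrans _ (mule1 _)); congr (_ * _)%E.
    exact: probability_setT.
  by apply/seteqP; split => -[x s] /=; rewrite /tcons /= ?tnth0//; case.
Qed.

(** Induction on [n], with Tonelli applied to head and tail. *)
Lemma ge0_integral_product_law n (P : 'I_n -> probability T R)
    (f : 'I_n -> T -> R) (r : 'I_n -> R) :
  (forall i, measurable_fun [set: T] (f i)) ->
  (forall i x, 0 <= f i x) ->
  (forall i, \int[P i]_x (f i x)%:E = (r i)%:E)%E ->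
  (\int[product_law P]_x (\prod_(i < n) f i (tnth x i))%:E =
   (\prod_(i < n) r i)%:E)%E.
Proof.
elim: n P f r => [|n IH] P f r mf f0 fr.
  rewrite big_ord0; under eq_integral do rewrite big_ord0.
  by rewrite integral_cst// mul1e; exact: probability_setT.
have mprod k (g : 'I_k -> T -> R) : (forall i, measurable_fun [set: T] (g i)) ->
    measurable_fun [set: k.-tuple T] (fun x => (\prod_(i < k) g i (tnth x i))%:E).
  move=> mg; apply/measurable_EFinP; apply: measurable_prod => i _.
  by apply: measurableT_comp => //; exact: measurable_tnth.
rewrite /= ge0_integral_pushforward//; last 2 first.
- exact: mprod.
- by move=> x _; rewrite lee_fin prodr_ge0.
rewrite preimage_setT fubini_tonelli1//=; last 2 first.
- by apply: measurableT_comp; [exact: mprod|exact: measurable_tcons].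
- by move=> x; rewrite lee_fin prodr_ge0.
transitivity
    (\int[P ord0]_x ((f ord0 x)%:E * (\prod_(i < n) r (lift ord0 i))%:E))%E.
  apply: eq_integral => x _; rewrite /fubini_F/=.
  rewrite -(IH (fun i => P (lift ord0 i)) (fun i => f (lift ord0 i)))//.
  rewrite -ge0_integralZl//; last 3 first.
  - exact: (mprod _ (fun i => f (lift ord0 i))).
  - by move=> s _; rewrite lee_fin prodr_ge0.
  - by rewrite lee_fin.
  apply: eq_integral => s _; rewrite -EFinM big_ord_recl tnth0.
  by congr (_ * _)%:E; apply: eq_bigr => i _; rewrite tnthS.
rewrite ge0_integralZr//; last 3 first.
- exact/measurable_EFinP.
- by move=> x _; rewrite lee_fin.
- rewrite lee_fin prodr_ge0// => i _; rewrite -lee_fin -fr integral_ge0// => x _.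
  by rewrite lee_fin.
by rewrite fr -EFinM big_ord_recl.
Qed.

Lemma integrable_product_law n (P : 'I_n -> probability T R) i (f : T -> R) :
  (P i).-integrable [set: T] (EFin \o f) ->
  (product_law P).-integrable [set: n.-tuple T] (fun x => (f (tnth x i))%:E).
Proof.
case/integrableP => mf fi; have mt := @measurable_tnth _ T n i.
apply/integrableP; split; first exact: (measurableT_comp mf mt).
have maf : measurable_fun [set: T] (fun x => `|(f x)%:E|%E) by exact: measurableT_comp.
have := ge0_integral_pushforward mt (product_law P) measurableT maf.
rewrite preimage_setT => <-//.
rewrite (eq_measure_integral (P i))// => A mA _.
exact: product_law_tnth.
Qed.

Lemma integral_product_law n (P : 'I_n -> probability T R) i (f : T -> R) :
  (P i).-integrable [set: T] (EFin \o f) ->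
  (\int[product_law P]_x (f (tnth x i))%:E = \int[P i]_x (f x)%:E)%E.
Proof.
move=> fi; have mt := @measurable_tnth _ T n i.
have := integral_pushforward mt (measurable_int _ fi)
  (integrable_product_law fi) measurableT.
rewrite preimage_setT => <-.
by apply: eq_measure_integral => A mA _; exact: product_law_tnth.
Qed.

End product_law.

(** * Products of functions of two independent variables *)

Section product_probability.
Context d1 d2 (T1 : measurableType d1) (T2 : measurableType d2) (R : realType).
Variables (P1 : probability T1 R) (P2 : probability T2 R).

Lemma integrable_prodM (f : T1 -> R) (g : T2 -> R) :
  P1.-integrable [set: T1] (EFin \o f) -> P2.-integrable [set: T2] (EFin \o g) ->
  (P1 \x P2)%E.-integrable [set: T1 * T2] (fun z => (f z.1 * g z.2)%:E).
Proof.
move=> fi gi.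
have mf : measurable_fun [set: T1] f by apply/measurable_EFinP; exact: measurable_int fi.
have mg : measurable_fun [set: T2] g by apply/measurable_EFinP; exact: measurable_int gi.
apply/integrable12ltyP.
  by apply/measurable_EFinP; apply: measurable_funM;
    apply: measurableT_comp.
under eq_integral => x _.
  under eq_integral do rewrite /= normrM EFinM.
  rewrite ge0_integralZl//; last first.
    by apply/measurable_EFinP; exact: measurableT_comp.
  over.
case/integrableP : fi => _ fi; case/integrableP : gi => _ gi.
rewrite ge0_integralZr//; last 2 first.
- by apply/measurable_EFinP; exact: measurableT_comp.
- exact: integral_ge0.
by rewrite lte_mul_pinfty// ?integral_ge0// ge0_fin_numE// integral_ge0.
Qed.

Lemma integral_prodM (f : T1 -> R) (g : T2 -> R) :
  P1.-integrable [set: T1] (EFin \o f) -> P2.-integrable [set: T2] (EFin \o g) ->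
  (\int[P1 \x P2]_z (f z.1 * g z.2)%:E =
   (\int[P1]_x (f x)%:E) * (\int[P2]_x (g x)%:E))%E.
Proof.
move=> fi gi; rewrite -integral12_prod_meas1; last exact: integrable_prodM.
have gfin := integrable_fin_num measurableT gi.
rewrite -[X in (_ * X)%E](fineK gfin).
rewrite -integralZr//; apply: eq_integral => x _; rewrite /fubini_F/=.
under eq_integral do rewrite EFinM.
by rewrite integralZl// fineK.
Qed.

End product_probability.

(** * A calculus of expectations *)

Section has_mean.
Context {R : realType}.

(** Integrability is bundled with the value, so that linearity and independence compose without
    separate side conditions. *)
Definition has_mean d (T : measurableType d) (P : probability T R)
    (f : T -> R) (e : R) :=
  P.-integrable [set: T] (EFin \o f) /\ (\int[P]_x (f x)%:E = e%:E)%E.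

Section linearity.
Context d (T : measurableType d) (P : probability T R).

Lemma has_mean_cst c : has_mean P (fun=> c) c.
Proof.
split; first exact: (finite_measure_integrable_cst P c measurableT).
by rewrite integral_cst// [X in (_ * X)%E]probability_setT mule1.
Qed.

Lemma has_meanD f g a b : has_mean P f a -> has_mean P g b ->
  has_mean P (fun x => f x + g x) (a + b).
Proof.
move=> [fi fa] [gi gb]; split; first exact: (integrableD measurableT fi gi).
by under eq_integral do rewrite EFinD; rewrite integralD// fa gb.
Qed.

Lemma has_meanZ k f a : has_mean P f a -> has_mean P (fun x => k * f x) (k * a).
Proof.
move=> [fi fa]; split; first exact: (integrableZl measurableT k fi).
by under eq_integral do rewrite EFinM; rewrite integralZl// fa.
Qed.

Lemma has_mean_sum n (f : 'I_n -> T -> R) (a : 'I_n -> R) :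
  (forall i, has_mean P (f i) (a i)) ->
  has_mean P (fun x => \sum_(i < n) f i x) (\sum_(i < n) a i).
Proof.
elim: n f a => [|n IH] f a fa.
  rewrite big_ord0 (_ : (fun _ => _) = (fun=> 0)); first exact: has_mean_cst.
  by apply/funext => x; rewrite big_ord0.
rewrite big_ord_recl (_ : (fun _ => _) =
    (fun x => f ord0 x + \sum_(i < n) f (lift ord0 i) x)); last first.
  by apply/funext => x; rewrite big_ord_recl.
by apply: has_meanD => //; apply: IH.
Qed.

End linearity.

Lemma has_mean_prodM d1 d2 (T1 : measurableType d1) (T2 : measurableType d2)
    (P1 : probability T1 R) (P2 : probability T2 R) f g a b :
  has_mean P1 f a -> has_mean P2 g b ->
  has_mean (P1 \x P2)%E (fun z => f z.1 * g z.2) (a * b).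
Proof.
move=> [fi fa] [gi gb]; split; first exact: integrable_prodM.
by rewrite integral_prodM// fa gb.
Qed.

Lemma has_mean_tnth d (T : measurableType d) n (P : 'I_n -> probability T R) i f a :
  has_mean (P i) f a -> has_mean (product_law P) (fun x => f (tnth x i)) a.
Proof.
move=> [fi fa]; split; first exact: integrable_product_law.
by rewrite integral_product_law.
Qed.

Lemma has_mean_gauss n (mu s : n.-tuple R) i : 0 < tnth s i ->
  has_mean (gauss_law mu s) (fun x => tnth x i - tnth mu i) 0.
Proof.
move=> s0.
apply: (@has_mean_tnth _ _ _ _ i (fun x : measurableTypeR R => x - tnth mu i)).
by split; [exact: integrable_normal_law_center|exact: integral_normal_law_center].
Qed.

Lemma has_mean_gauss_sqr n (mu s : n.-tuple R) i : 0 < tnth s i ->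
  has_mean (gauss_law mu s) (fun x => (tnth x i - tnth mu i) ^+ 2) (tnth s i).
Proof.
move=> s0.
apply: (@has_mean_tnth _ _ _ _ i (fun x : measurableTypeR R => (x - tnth mu i) ^+ 2)).
by split; [exact: integrable_normal_law_sqr|exact: integral_normal_law_sqr].
Qed.

End has_mean.

(** * Closed form of the Bayes predictive density *)

Section predictive.
Context (R : realType) (n m : nat).
Hypotheses (n_gt0 : (0 < n)%N) (m_gt0 : (0 < m)%N).

Lemma v_gt0 k : (0 < k)%N -> 0 < v R k.
Proof. by move=> k0; rewrite invr_gt0 ltr0n. Qed.

Lemma v_decr : v R (n + m) < v R n.
Proof.
by rewrite ltf_pV2 ?posrE ?ltr0n ?addn_gt0 ?n_gt0// ltr_nat -[ltnLHS]addn0 ltn_add2l.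
Qed.

(* Precisions add up: [1 / v_(n+m) = 1 / v_n + 1 / v_m]. *)
Lemma v_harmonic : v R m = v R n * v R (n + m) / (v R n - v R (n + m)).
Proof.
rewrite /v natrD.
have n0 : 0 < n%:R :> R by rewrite ltr0n.
have m0 : 0 < m%:R :> R by rewrite ltr0n.
have nm0 : 0 < n%:R + m%:R :> R by rewrite addr_gt0.
by field; rewrite mulN1r addrAC subrr add0r !gt_eqF.
Qed.

Let vn_gt0 : 0 < v R n. Proof. exact: v_gt0. Qed.
Let vm_gt0 : 0 < v R m. Proof. exact: v_gt0. Qed.

Definition post_mean (S x : n.-tuple R) : n.-tuple R :=
  [tuple tnth S i / (tnth S i + v R n) * tnth x i | i < n].

(** Posterior variance plus the noise variance of the future observation. *)
Definition pred_var (S : n.-tuple R) : n.-tuple R :=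
  [tuple tnth S i * v R n / (tnth S i + v R n) + v R m | i < n].

Lemma pred_var_gt0 S i : nonneg_diag S -> 0 < tnth (pred_var S) i.
Proof.
move=> S0; rewrite tnth_mktuple ltr_wpDl// divr_ge0 ?addr_ge0// ?mulr_ge0// ltW//.
Qed.

(** Numerator and denominator factor over the coordinates; the common marginal densities of [x] are
    positive, even where [S] vanishes, and cancel. *)
Lemma bayes_predE (S x xt : n.-tuple R) : nonneg_diag S ->
  bayes_pred m S x xt = gauss_pdf (post_mean S x) (pred_var S) xt.
Proof.
move=> S0; rewrite /bayes_pred /Rintegral /gauss_law.
pose P i := normal_law (tnth [tuple (0 : R) | i < n] i) (tnth S i).
have den : (\int[product_law P]_t (gauss_pdf t (vI R n n) x)%:E =
    (\prod_(i < n) normal_pdf 0 (Num.sqrt (tnth S i + v R n)) (tnth x i))%:E)%E.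
  rewrite -(@ge0_integral_product_law _ _ _ _ P (fun i t =>
    normal_pdf t (Num.sqrt (v R n)) (tnth x i))).
  - apply: eq_integral => t _; congr EFin; apply: eq_bigr => i _.
    by rewrite tnth_mktuple.
  - by move=> i; apply/measurable_EFinP; exact: measurable_normal_pdf_mean.
  - by move=> i t; rewrite normal_pdf_ge0.
  - by move=> i; rewrite /P tnth_mktuple integral_normal_law_pdf.
have num : (\int[product_law P]_t
    (gauss_pdf t (vI R n n) x * gauss_pdf t (vI R m n) xt)%:E =
    (\prod_(i < n) (normal_pdf 0 (Num.sqrt (tnth S i + v R n)) (tnth x i) *
      normal_pdf ((tnth S i * tnth x i + v R n * 0) / (tnth S i + v R n))
        (Num.sqrt (tnth S i * v R n / (tnth S i + v R n) + v R m)) (tnth xt i)))%:E)%E.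
  rewrite -(@ge0_integral_product_law _ _ _ _ P (fun i t =>
    normal_pdf t (Num.sqrt (v R n)) (tnth x i) *
    normal_pdf t (Num.sqrt (v R m)) (tnth xt i))).
  - apply: eq_integral => t _; congr EFin; rewrite -big_split; apply: eq_bigr => i _.
    by rewrite !tnth_mktuple.
  - by move=> i; apply: measurable_funM; apply/measurable_EFinP;
      exact: measurable_normal_pdf_mean.
  - by move=> i t; rewrite mulr_ge0 ?normal_pdf_ge0.
  - by move=> i; rewrite /P tnth_mktuple integral_normal_law_pdf2.
rewrite num den /= big_split/= mulrAC mulfV ?mul1r; last first.
  apply/prodf_neq0 => i _.
  by rewrite gt_eqF// normal_pdf_sqrt_gt0// ltr_wpDl.
by rewrite /gauss_pdf; apply: eq_bigr => i _; rewrite !tnth_mktuple mulr0 addr0 mulrAC.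
Qed.

End predictive.

(** * The risk of one coordinate and its minimizer *)

Section coordinate_risk.
Context {R : realType}.
Implicit Types p q s t : R.

(* The contribution of one coordinate to [m] times the risk, with [p = v_n],
   [q = v_(n+m)], prior variance [s] and squared mean [t]. *)
Definition coord_risk p q s t : R :=
  2^-1 * (ln (p / q) + ln ((s + q) / (s + p)) +
          (p - q) * (t - s) / ((s + p) * (s + q))).

(** The difference of the logarithms is [ln (1 + u) <= u], and the tangent increment exceeds [u] by
    a positive multiple of [(t - s)^2], which gives strictness. *)
Lemma ln_prod_ratio_lt p q s t : 0 < q -> q < p -> 0 <= s -> 0 <= t -> s != t ->
  ln ((t + q) / (t + p)) <
  ln ((s + q) / (s + p)) + (p - q) * (t - s) / ((s + p) * (s + q)).
Proof.
move=> q0 qp s0 t0 st; have p0 := lt_trans q0 qp.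
have sp : 0 < s + p by rewrite ltr_wpDl.
have sq : 0 < s + q by rewrite ltr_wpDl.
have tp : 0 < t + p by rewrite ltr_wpDl.
have tq : 0 < t + q by rewrite ltr_wpDl.
rewrite -ltrBlDl -ln_div ?posrE ?divr_gt0//.
have -> : (t + q) / (t + p) / ((s + q) / (s + p)) =
    1 + (p - q) * (t - s) / ((t + p) * (s + q)).
  by field; rewrite !gt_eqF.
set u := _ / _; apply: (@le_lt_trans _ _ u).
  rewrite le_ln1Dx// /u ltr_pdivlMr ?mulr_gt0// mulN1r.
  nra.
rewrite -subr_gt0.
have -> : (p - q) * (t - s) / ((s + p) * (s + q)) - u =
    (p - q) * (t - s) ^+ 2 / ((s + p) * (s + q) * (t + p)).
  by rewrite /u; field; rewrite !gt_eqF.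
have ts2 : 0 < (t - s) ^+ 2 by rewrite exprn_even_gt0//= subr_eq0 eq_sym.
by apply: divr_gt0; [apply: mulr_gt0 => //; rewrite subr_gt0|rewrite !mulr_gt0].
Qed.

Lemma coord_risk_diag p q t :
  coord_risk p q t t = 2^-1 * (ln (p / q) + ln ((t + q) / (t + p))).
Proof. by rewrite /coord_risk subrr mulr0 mul0r addr0. Qed.

Lemma coord_risk_lt p q s t : 0 < q -> q < p -> 0 <= s -> 0 <= t -> s != t ->
  coord_risk p q t t < coord_risk p q s t.
Proof.
move=> q0 qp s0 t0 st; rewrite coord_risk_diag ltr_pM2l ?invr_gt0//.
by rewrite -addrA ltrD2l ln_prod_ratio_lt.
Qed.

Lemma coord_risk_le p q s t : 0 < q -> q < p -> 0 <= s -> 0 <= t ->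
  coord_risk p q t t <= coord_risk p q s t.
Proof.
move=> q0 qp s0 t0; have [->//|st] := eqVneq s t.
by rewrite ltW// coord_risk_lt.
Qed.

Lemma ln_prod n (f : 'I_n -> R) : (forall i, 0 < f i) ->
  ln (\prod_(i < n) f i) = \sum_(i < n) ln (f i).
Proof.
elim: n f => [|n IH] f f0; first by rewrite !big_ord0 ln1.
by rewrite !big_ord_recl lnM ?posrE ?IH// prodr_gt0.
Qed.

Lemma ln_normal_pdf mu s (y : R) : 0 < s ->
  ln (normal_pdf mu (Num.sqrt s) y) =
  - (2^-1 * (ln s + ln (2 * pi))) - (y - mu) ^+ 2 / (2 * s).
Proof.
move=> s0; have pi2 : 0 < 2 * pi :> R by rewrite mulr_gt0 ?pi_gt0.
have ps : 0 < s * (2 * pi) by rewrite mulr_gt0.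
have qs : 0 < Num.sqrt (s * (2 * pi)) by rewrite sqrtr_gt0.
rewrite normal_pdf_sqrtE// [LHS]lnM ?posrE ?invr_gt0 ?expR_gt0// expRK lnV ?posrE//.
rewrite -lnM ?posrE// -{2}(sqr_sqrtr (ltW ps)) lnXn//.
by congr (- _ + _); field.
Qed.

Lemma ln_normal_pdf_div mu nu s t (y : R) : 0 < s -> 0 < t ->
  ln (normal_pdf mu (Num.sqrt s) y / normal_pdf nu (Num.sqrt t) y) =
  2^-1 * ln (t / s) + ((y - nu) ^+ 2 / (2 * t) - (y - mu) ^+ 2 / (2 * s)).
Proof.
move=> s0 t0; rewrite !ln_div ?posrE ?normal_pdf_sqrt_gt0// !ln_normal_pdf//.
ring.
Qed.

End coordinate_risk.

(** * The risk as a sum over coordinates *)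

Section risk.
Context (R : realType) (n m : nat).
Hypotheses (n_gt0 : (0 < n)%N) (m_gt0 : (0 < m)%N).

(** The log ratio is quadratic in the centred observations, so only their means, variances and
    independence enter. *)
Lemma riskE (theta S : n.-tuple R) : nonneg_diag S ->
  risk m theta (bayes_pred m S) =
  (m%:R^-1 * \sum_(i < n)
     coord_risk (v R n) (v R (n + m)) (tnth S i) (tnth theta i ^+ 2))%:E.
Proof.
move=> S0; rewrite /risk EFinM; congr (_ * _)%E.
have vn0 : 0 < v R n by exact: v_gt0.
have vm0 : 0 < v R m by exact: v_gt0.
pose c i := tnth S i / (tnth S i + v R n).
pose r i := tnth (pred_var m S) i.
have r0 i : 0 < r i by exact: pred_var_gt0.
pose th i := tnth theta i.
(* Expansion of the squares with [y - c x = (y - th) - c (x - th) + (1 - c) th]. Factors [1] are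
   kept so that every random term has the shape [k * (f z.1 * g z.2)] of [has_mean_prodM]. *)
pose integrand (z : n.-tuple R * n.-tuple R) := \sum_(i < n)
  (2^-1 * (ln (r i / v R m) + ((1 - c i) * th i) ^+ 2 / r i) +
   (((2 * r i)^-1 - (2 * v R m)^-1) * (1 * (tnth z.2 i - th i) ^+ 2) +
   (c i ^+ 2 / (2 * r i) * ((tnth z.1 i - th i) ^+ 2 * 1) +
   (- (c i / r i) * ((tnth z.1 i - th i) * (tnth z.2 i - th i)) +
   ((1 - c i) * th i / r i * (1 * (tnth z.2 i - th i)) +
    - (c i * (1 - c i) * th i / r i) * ((tnth z.1 i - th i) * 1)))))).
rewrite (_ : (fun z => _) = (fun z => (integrand z)%:E)); last first.
  apply/funext => -[x y] /=; rewrite bayes_predE//.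
  have r'0 i : normal_pdf (tnth (post_mean S x) i) (Num.sqrt (r i)) (tnth y i) != 0.
    by rewrite gt_eqF// normal_pdf_sqrt_gt0.
  (* Positivity reduces the extended-real quotient and logarithm to real ones. *)
  have g0 : 0 < gauss_pdf (post_mean S x) (pred_var m S) y.
    by apply: prodr_gt0 => i _; exact: normal_pdf_sqrt_gt0.
  rewrite inver (gt_eqF g0) -EFinM lne_EFin; last first.
    rewrite divr_gt0//; apply: prodr_gt0 => i _.
    by rewrite normal_pdf_sqrt_gt0// tnth_mktuple.
  congr EFin; rewrite /gauss_pdf -prodf_div ln_prod; last first.
    by move=> i; apply: divr_gt0; apply: normal_pdf_sqrt_gt0 => //; rewrite tnth_mktuple.
  apply: eq_bigr => i _; rewrite -/(r i) -/(th i) tnth_mktuple.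
  rewrite (_ : tnth (post_mean S x) i = c i * tnth x i) ?tnth_mktuple//.
  rewrite ln_normal_pdf_div//.
  by field; rewrite !gt_eqF.
have [_ ->] : has_mean
    (gauss_law theta (vI R n n) \x gauss_law theta (vI R m n))%E integrand
    (\sum_(i < n) (2^-1 * (ln (r i / v R m) + ((1 - c i) * th i) ^+ 2 / r i) +
     (((2 * r i)^-1 - (2 * v R m)^-1) * (1 * v R m) +
     (c i ^+ 2 / (2 * r i) * (v R n * 1) +
     (- (c i / r i) * (0 * 0) + ((1 - c i) * th i / r i * (1 * 0) +
     - (c i * (1 - c i) * th i / r i) * (0 * 1))))))).
  apply: has_mean_sum => i.
  have X1 := has_mean_gauss theta (_ : 0 < tnth (vI R n n) i).
  have Y1 := has_mean_gauss theta (_ : 0 < tnth (vI R m n) i).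
  have X2 := has_mean_gauss_sqr theta (_ : 0 < tnth (vI R n n) i).
  have Y2 := has_mean_gauss_sqr theta (_ : 0 < tnth (vI R m n) i).
  rewrite !tnth_mktuple in X1 X2 Y1 Y2.
  have one1 := has_mean_cst (gauss_law theta (vI R n n)) 1.
  have one2 := has_mean_cst (gauss_law theta (vI R m n)) 1.
  do !apply: has_meanD; [exact: has_mean_cst|..]; apply: has_meanZ.
  - exact: has_mean_prodM one1 (Y2 vm0).
  - exact: has_mean_prodM (X2 vn0) one2.
  - exact: has_mean_prodM (X1 vn0) (Y1 vm0).
  - exact: has_mean_prodM one1 (Y1 vm0).
  - exact: has_mean_prodM (X1 vn0) one2.
congr EFin; apply: eq_bigr => i _.
have := v_decr R n_gt0 m_gt0; have := v_gt0 R (ltn_addr m n_gt0).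
have si := S0 i; rewrite /r tnth_mktuple /c -/(th i) /coord_risk.
have := v_harmonic R n_gt0 m_gt0; move: (th i) => t.
move: (v R m) (v R n) (v R (n + m)) vm0 vn0 (tnth S i) si.
move=> w p q _ p0 s s0 -> q0 qp.
have pq0 : 0 < p - q by rewrite subr_gt0.
have sp0 : 0 < s + p by rewrite ltr_wpDl.
have sq0 : 0 < s + q by rewrite ltr_wpDl.
(* With [v_m = p q / (p - q)], the ratio of predictive to noise variance is
   [(p / q) (s + q) / (s + p)]. Both sides then carry the same logarithm, and a rational identity
   remains. *)
have -> : s * p / (s + p) + p * q / (p - q) =
    p ^+ 2 * (s + q) / ((s + p) * (p - q)).
  by field; rewrite !gt_eqF.
rewrite -lnM ?posrE ?divr_gt0//.
have -> : p / q * ((s + q) / (s + p)) =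
    p ^+ 2 * (s + q) / ((s + p) * (p - q)) / (p * q / (p - q)).
  by field; rewrite !gt_eqF.
by field; rewrite !gt_eqF.
Qed.

End risk.

(** * The two saddle-point inequalities *)

Section pinsker.
Context (R : realType) (n m : nat) (C : R) (a : nat -> R) (lambda : R).
Hypotheses (n_gt0 : (0 < n)%N) (m_gt0 : (0 < m)%N) (C_gt0 : 0 < C).
Hypothesis a_gt0 : forall i, 0 < a i.
Hypothesis lambdaE :
  \sum_(i < n) a i ^+ 2 * pinsker_weight n m lambda (a i) = 2 * C.

Let p := v R n.
Let q := v R (n + m).
Let V : n.-tuple R := pinsker_var n m a lambda.
Let Theta : set (n.-tuple R) := ellipsoid a C.

Let q_gt0 : 0 < q. Proof. exact: v_gt0 (ltn_addr m n_gt0). Qed.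
Let qp : q < p. Proof. exact: v_decr. Qed.
Let p_gt0 : 0 < p. Proof. exact: lt_trans qp. Qed.

Lemma pinsker_var_ge0 : nonneg_diag V.
Proof. by move=> i; rewrite tnth_mktuple divr_ge0// le_max lexx orbT. Qed.

Lemma sum_pinsker_var : \sum_(i < n) a i ^+ 2 * tnth V i = C.
Proof.
apply: (@mulfI _ 2) => //; rewrite -lambdaE mulr_sumr; apply: eq_bigr => i _.
by rewrite tnth_mktuple; field.
Qed.

(** For [lambda <= 0] the root is at most 1, each bracket is at most [-2 q], and all weights vanish,
    against [C > 0]. *)
Lemma lambda_gt0 : 0 < lambda.
Proof.
rewrite ltNge; apply/negP => l0.
suff : 2 * C = 0 by apply/eqP; rewrite gt_eqF// mulr_gt0.
rewrite -lambdaE big1// => i _; apply/eqP; rewrite mulf_eq0; apply/orP; right.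
rewrite /pinsker_weight /pos_part -/p -/q; apply/eqP/max_idPr.
have pq0 : 0 < p - q by rewrite subr_gt0.
(* Here [x] may be negative; [Num.sqrt] is then [0] and the bound persists. *)
set x := 1 + _; have : Num.sqrt x <= 1.
  rewrite -[leRHS]sqrtr1 ler_wsqrtr// /x gerDl.
  rewrite pmulr_lle0 ?invr_gt0// pmulr_lle0 ?invr_gt0 ?exprn_gt0//.
  by rewrite pmulr_rle0.
rewrite -(ler_pM2l pq0) mulr1 => h.
by rewrite subr_le0 (le_trans h)//; have := q_gt0; lra.
Qed.

(* The multiplier of the constraint [sum_i a_i^2 t_i <= C] is [lambda^-1]. *)
Lemma pinsker_kkt (i : 'I_n) (s := tnth V i) :
  (p - q) / ((s + p) * (s + q)) <= a i ^+ 2 / lambda /\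
  (p - q) / ((s + p) * (s + q)) * s = a i ^+ 2 / lambda * s.
Proof.
have l0 := lambda_gt0; have a2 : 0 < a i ^+ 2 by rewrite exprn_gt0.
have pq0 : 0 < p - q by rewrite subr_gt0.
have := pinsker_var_ge0 i; rewrite -/s.
have : s = pos_part ((p - q) *
    Num.sqrt (1 + (4 * lambda / a i ^+ 2) / (p - q)) - (p + q)) / 2.
  by rewrite /s tnth_mktuple.
set x := 1 + _; have x0 : 0 < x by rewrite addr_gt0// !divr_gt0// mulr_gt0.
have xE : (Num.sqrt x * (p - q)) ^+ 2 = (p - q) ^+ 2 + 4 * (lambda * (p - q) / a i ^+ 2).
  rewrite exprMn sqr_sqrtr ?(ltW x0)// /x; field.
  by rewrite !gt_eqF.
(* If the bracket is nonpositive then [s = 0], and squaring gives [lambda (p - q) / a_i^2 <= p q],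
   using [(p + q)^2 - (p - q)^2 = 4 p q]. *)
rewrite /pos_part maxEle; case: ifPn => [h|].
  rewrite mul0r => -> _; rewrite !mulr0 !add0r; split => //.
  rewrite ler_pdivrMr ?mulr_gt0// mulrAC ler_pdivlMr//.
  have : (Num.sqrt x * (p - q)) ^+ 2 <= (p + q) ^+ 2.
    have h' : Num.sqrt x * (p - q) <= p + q by rewrite mulrC -subr_le0.
    have sx0 : 0 <= Num.sqrt x * (p - q) by rewrite mulr_ge0// ltW.
    by rewrite !expr2 ler_pM.
  rewrite xE => {}h; have : lambda * (p - q) / a i ^+ 2 <= p * q by nra.
  by rewrite ler_pdivrMr// mulrC (mulrC (a i ^+ 2)).
rewrite -ltNge => h sE s0.
(* Otherwise squaring gives equality, by [(2 s + p + q)^2 - (p - q)^2 = 4 (s + p) (s + q)]. *)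
have {}sE : Num.sqrt x * (p - q) = 2 * s + p + q by rewrite sE; field.
suff -> : (p - q) / ((s + p) * (s + q)) = a i ^+ 2 / lambda by [].
have spq : 0 < (s + p) * (s + q) by rewrite mulr_gt0// ltr_wpDl.
have : (s + p) * (s + q) = lambda * (p - q) / a i ^+ 2.
  by move: xE; rewrite sE; nra.
move=> ->; field; rewrite !gt_eqF//.
Qed.

Definition linear_value : R :=
  m%:R^-1 * \sum_(i < n) coord_risk p q (tnth V i) (tnth V i).

Lemma linear_valueE : linear_value =
  n%:R / (2 * m%:R) * ln (p / q) +
  (2 * m%:R)^-1 * \sum_(i < n) ln ((q + tnth V i) / (p + tnth V i)).
Proof.
rewrite /linear_value.
under eq_bigr do rewrite coord_risk_diag.
rewrite -mulr_sumr big_split/= sumr_const card_ord -mulr_natl.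
under [in RHS]eq_bigr do rewrite (addrC q) (addrC p).
by field; rewrite gt_eqF// ltr0n.
Qed.

(** Replacing the slopes by [a_i^2 / lambda] can only lower the gap to [linear_value], by
    [pinsker_kkt]; what remains is the slack of the ellipsoid constraint divided by [lambda]. *)
Lemma risk_pinsker_le (theta : n.-tuple R) : Theta theta ->
  (risk m theta (bayes_pred m V) <= linear_value%:E)%E.
Proof.
move=> thC; rewrite riskE//; last exact: pinsker_var_ge0.
rewrite lee_fin ler_pM2l ?invr_gt0 ?ltr0n// -subr_ge0 -sumrB.
rewrite (eq_bigr (fun i => 2^-1 * ((p - q) /
  ((tnth V i + p) * (tnth V i + q)) * (tnth V i - tnth theta i ^+ 2)))); last first.
  by move=> i _; rewrite coord_risk_diag /coord_risk -/p -/q; ring.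
rewrite -mulr_sumr mulr_ge0//.
apply: (@le_trans _ _ (\sum_(i < n)
  (a i ^+ 2 / lambda * (tnth V i - tnth theta i ^+ 2)))); last first.
  apply: ler_sum => i _; have [k1 k2] := pinsker_kkt i.
  by rewrite [leLHS]mulrBr [leRHS]mulrBr k2 lerD2l lerN2 ler_wpM2r ?sqr_ge0.
have -> : \sum_(i < n) (a i ^+ 2 / lambda * (tnth V i - tnth theta i ^+ 2)) =
    lambda^-1 * (C - \sum_(i < n) a i ^+ 2 * tnth theta i ^+ 2).
  rewrite -sum_pinsker_var -sumrB mulr_sumr; apply: eq_bigr => i _; ring.
by rewrite mulr_ge0 ?invr_ge0 ?(ltW lambda_gt0)// subr_ge0.
Qed.

(** The least favourable point; only the squares of its coordinates matter. *)
Let theta0 : n.-tuple R := [tuple Num.sqrt (tnth V i) | i < n].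

Let theta0_sqr i : tnth theta0 i ^+ 2 = tnth V i.
Proof. by rewrite tnth_mktuple sqr_sqrtr// pinsker_var_ge0. Qed.

Lemma ellipsoid_sqrt_pinsker : Theta theta0.
Proof.
rewrite /Theta /ellipsoid /= -[leRHS]sum_pinsker_var.
by under eq_bigr do rewrite theta0_sqr.
Qed.

Lemma risk_sqrt_pinsker_ge (S : n.-tuple R) : nonneg_diag S ->
  (linear_value%:E <= risk m theta0 (bayes_pred m S))%E.
Proof.
move=> S0; rewrite riskE// lee_fin ler_pM2l ?invr_gt0 ?ltr0n//.
apply: ler_sum => i _; rewrite theta0_sqr.
exact: coord_risk_le q_gt0 qp (S0 i) (pinsker_var_ge0 i).
Qed.

(** One differing coordinate costs strictly more, and no other coordinate can compensate. This
    yields uniqueness of the minimax estimator. *)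
Lemma risk_sqrt_pinsker_inj (S : n.-tuple R) : nonneg_diag S ->
  (risk m theta0 (bayes_pred m S) <= linear_value%:E)%E -> S = V.
Proof.
move=> S0; rewrite riskE// lee_fin ler_pM2l ?invr_gt0 ?ltr0n// => le.
apply/eq_from_tnth => i; apply/eqP/negPn/negP => SV; move: le; apply/negP.
rewrite -ltNge (bigD1 i)//= [ltRHS](bigD1 i)//= ltr_leD//.
  by rewrite theta0_sqr coord_risk_lt// pinsker_var_ge0.
apply: ler_sum => j _; rewrite theta0_sqr.
exact: coord_risk_le q_gt0 qp (S0 j) (pinsker_var_ge0 j).
Qed.

End pinsker.

(** * Minimax equality, optimality and uniqueness *)

Unset Implicit Arguments.

Theorem theorem3p2 (R : realType) (n m : nat) (C : R) (a : nat -> R) (lambda : R)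
    (n_ge1 : (1 <= n)%N) (le_nm : (n <= m)%N) (C_gt0 : 0 < C)
    (a_gt0 : forall i, 0 < a i)
    (a_nondecr : forall i j, (i <= j)%N -> a i <= a j)
    (a_cvg : a i @[i --> \oo] --> +oo)
    (lambdaE : \sum_(i < n) a i ^+ 2 * pinsker_weight n m lambda (a i) = 2 * C) :
  let Theta : set (n.-tuple R) := ellipsoid a C in
  let V : n.-tuple R := pinsker_var n m a lambda in
  [/\ linear_minimax_risk m Theta = linear_maximin_risk m Theta,
      linear_minimax_risk m Theta =
        (n%:R / (2 * m%:R) * ln (v R n / v R (n + m)) +
         (2 * m%:R)^-1 *
           \sum_(i < n) ln ((v R (n + m) + tnth V i) / (v R n + tnth V i)))%:E,
      max_risk m Theta V = linear_minimax_risk m Theta,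
      (forall S : n.-tuple R, nonneg_diag S ->
        max_risk m Theta S = linear_minimax_risk m Theta ->
        bayes_pred m S = bayes_pred m V)
    & forall x xt : n.-tuple R,
        bayes_pred m V x xt =
        gauss_pdf [tuple tnth V i / (tnth V i + v R n) * tnth x i | i < n]
                  [tuple tnth V i * v R n / (tnth V i + v R n) + v R m | i < n]
                  xt].
Proof.
move=> Theta V; have m_gt0 : (0 < m)%N by exact: leq_trans n_ge1 le_nm.
have V0 : nonneg_diag V by exact: pinsker_var_ge0.
set val := linear_value n m a lambda.
set theta0 : n.-tuple R := [tuple Num.sqrt (tnth V i) | i < n].
have theta0C : Theta theta0 by exact: ellipsoid_sqrt_pinsker.
have maximin_ge : (val%:E <= linear_maximin_risk m Theta)%E.
  apply: le_ereal_sup_tmp; exists (ereal_inf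
      [set risk m theta0 (bayes_pred m S) | S in @nonneg_diag R n]).
    by exists theta0.
  by apply: le_ereal_inf_tmp => _ [S S0 <-]; exact: risk_sqrt_pinsker_ge.
(* Weak duality: [risk m theta (bayes_pred m S)] separates the inner infimum from the inner
   supremum. *)
have maximin_le : (linear_maximin_risk m Theta <= linear_minimax_risk m Theta)%E.
  apply: ge_ereal_sup => _ [theta thC <-]; apply: le_ereal_inf_tmp => _ [S S0 <-].
  apply: (@le_trans _ _ (risk m theta (bayes_pred m S))).
    by apply: ereal_inf_lbound; exists S.
  by apply: ereal_sup_ubound; exists theta.
have minimax_le : (linear_minimax_risk m Theta <= max_risk m Theta V)%E.
  by apply: ereal_inf_lbound; exists V.
have max_le : (max_risk m Theta V <= val%:E)%E.
  apply: ge_ereal_sup => _ [theta thC <-].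
  exact: (risk_pinsker_le n_ge1 m_gt0 C_gt0 a_gt0 lambdaE thC).
(* The chain from [val] through maximin, minimax and [max_risk m Theta V] back to [val]
   collapses. *)
have minimaxE : linear_minimax_risk m Theta = val%:E.
  apply/eqP; rewrite eq_le (le_trans minimax_le max_le).
  exact: le_trans maximin_ge maximin_le.
split.
- by apply/eqP; rewrite eq_le maximin_le minimaxE maximin_ge.
- by rewrite minimaxE /val linear_valueE.
- by apply/eqP; rewrite eq_le minimax_le andbT minimaxE.
(* An optimal [S] has risk at most [val] at [theta0], which forces [S = V]. *)
- move=> S S0; rewrite minimaxE => SE; congr bayes_pred.
  apply: (risk_sqrt_pinsker_inj n_ge1 m_gt0 S0); rewrite -/theta0 -/val -SE.
  by apply: ereal_sup_ubound; exists theta0.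
- by move=> x xt; rewrite bayes_predE.
Qed.
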